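(* Let $A, B \in \mathbb{R}$ be constants with $A \neq 0$ and $B \neq 0$. The radius of convergence of the power series $$u = \sum_{n=0}^\infty c_n A^{n+1} B^n w^{2n+1}$$ in the variable $w$, where $c_n$ is the $n$-th Catalan number, is $\frac{1}{2\sqrt{|AB|}}$.
   Context: The Catalan numbers $c_n$ ($n \geq 0$) are defined by $c_0 = 1$ and $c_n = \sum_{i+j=n-1} c_i c_j$ for $n \geq 1$ (sum over nonnegative integers $i,j$); equivalently $c_n = \frac{1}{n+1}\binom{2n}{n}$. *)

(* Defs.v *)
From Stdlib Require Import Reals Lra Lia Arith List.
From Coquelicot Require Import Coquelicot.
Import ListNotations.
Open Scope R_scope.

(** [catalan_list n] is [c_n; c_(n-1); ...; c_0], so pairing the list with its
    reverse yields the products c_i c_j with i + j = n. *)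
Fixpoint catalan_list (n : nat) : list nat :=
  match n with
  | O => [1%nat]
  | S m =>
      let l := catalan_list m in
      list_sum (map (fun p => (fst p * snd p)%nat) (combine l (rev l))) :: l
  end.

Definition catalan (n : nat) : nat := hd 0%nat (catalan_list n).

Lemma catalan_list_eq (n : nat) :
  catalan_list n = rev (map catalan (seq 0 (S n))).
Proof.
  induction n as [|n IH]; [reflexivity|].
  rewrite seq_S, map_app, rev_app_distr, <- IH. reflexivity.
Qed.

Lemma map_rev_seq (n : nat) :
  rev (seq 0 (S n)) = map (fun i => (n - i)%nat) (seq 0 (S n)).
Proof.
  apply nth_ext with (d := 0%nat) (d' := (n - 0)%nat).
  - now rewrite length_rev, length_map.
  - rewrite length_rev, length_seq; intros k Hk.
    rewrite rev_nth; rewrite length_seq; [|exact Hk].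
    rewrite (map_nth (fun i => (n - i)%nat)), !seq_nth; lia.
Qed.

Lemma combine_map_map {T U V : Type} (f : T -> U) (g : T -> V) (l : list T) :
  combine (map f l) (map g l) = map (fun x => (f x, g x)) l.
Proof. induction l as [|x l IH]; simpl; [|rewrite IH]; reflexivity. Qed.

Lemma catalan_0 : catalan 0 = 1%nat.
Proof. reflexivity. Qed.

Lemma catalan_S (n : nat) :
  catalan (S n) =
  list_sum (map (fun i => (catalan i * catalan (n - i))%nat) (seq 0 (S n))).
Proof.
  change (catalan (S n)) with
    (list_sum (map (fun p => (fst p * snd p)%nat)
       (combine (catalan_list n) (rev (catalan_list n))))).
  rewrite catalan_list_eq, rev_involutive, <- map_rev, map_rev_seq, map_map,
    combine_map_map, map_map.
  f_equal; apply map_ext; intros i; simpl; lia.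
Qed.

(** The coefficient of w^m in the series sum_n c_n A^(n+1) B^n w^(2n+1). *)
Definition u_coef (A B : R) (m : nat) : R :=
  if Nat.odd m then
    let n := Nat.div2 m in INR (catalan n) * A ^ (n + 1) * B ^ n
  else 0.

Lemma u_coef_odd (A B : R) (n : nat) :
  u_coef A B (2 * n + 1) = INR (catalan n) * A ^ (n + 1) * B ^ n.
Proof.
  unfold u_coef. rewrite Nat.odd_odd, Nat.add_1_r, Nat.div2_succ_double.
  reflexivity.
Qed.

Lemma u_coef_even (A B : R) (n : nat) : u_coef A B (2 * n) = 0.
Proof. unfold u_coef. now rewrite Nat.odd_even. Qed.

Lemma u_coef_sum (A B w : R) (N : nat) :
  sum_f_R0 (fun m => u_coef A B m * w ^ m) (2 * N + 1) =
  sum_f_R0 (fun n => INR (catalan n) * A ^ (n + 1) * B ^ n * w ^ (2 * n + 1)) N.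
Proof.
  induction N as [|N IH].
  - change (2 * 0 + 1)%nat with 1%nat. simpl. unfold u_coef; simpl; ring.
  - rewrite tech5, <- IH.
    replace (2 * S N + 1)%nat with (S (S (2 * N + 1))) by lia.
    rewrite 2!tech5.
    replace (S (S (2 * N + 1))) with (2 * S N + 1)%nat by lia.
    replace (S (2 * N + 1)) with (2 * S N)%nat by lia.
    rewrite u_coef_odd, u_coef_even. ring.
Qed.

(* Main.v *)
(** Let C(y) be the generating function of the Catalan numbers.  The recurrence
    reads C = 1 + y C^2.  Applied to partial sums at y = 1/4 it gives
    S_(N+1) <= 1 + S_N^2 / 4, so S_N <= 2 and c_n / 4^n is bounded.  Conversely,
    if c_n t^n is bounded with t > 1/4, then C converges at some y > 1/4, where
    the quadratic equation C = 1 + y C^2 has negative discriminant 1 - 4y.  The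
    radius of u follows from w^2 |AB| = y. *)
Require Import Defs.
From Stdlib Require Import Reals Lra Lia List.
From Coquelicot Require Import Coquelicot.
Open Scope R_scope.

Lemma INR_list_sum_seq (f : nat -> nat) (n : nat) :
  INR (list_sum (map f (seq 0 (S n)))) = sum_f_R0 (fun i => INR (f i)) n.
Proof.
  induction n as [|n IH].
  - simpl. now rewrite Nat.add_0_r.
  - rewrite seq_S, map_app, list_sum_app, plus_INR, IH, tech5.
    simpl list_sum. now rewrite Nat.add_0_r.
Qed.

Lemma INR_catalan_S (n : nat) :
  INR (catalan (S n)) =
  sum_f_R0 (fun i => INR (catalan i) * INR (catalan (n - i))) n.
Proof.
  rewrite catalan_S, INR_list_sum_seq.
  apply sum_eq; intros i _. apply mult_INR.
Qed.

(** The squared partial sum has all products a_i a_j with i, j <= N; the left side keeps those with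
    i + j <= N, and the others are nonnegative. *)
Lemma cauchy_sum_le (a : nat -> R) (N : nat) :
  (forall n, 0 <= a n) ->
  sum_f_R0 (fun k => sum_f_R0 (fun i => a i * a (k - i)%nat) k) N
  <= sum_f_R0 a N * sum_f_R0 a N.
Proof.
  intros Ha. destruct N as [|N]; [simpl; lra|].
  rewrite (cauchy_finite a a (S N)) by lia.
  match goal with |- ?x <= ?x + ?y => enough (0 <= y) by lra end.
  apply cond_pos_sum; intros k. apply cond_pos_sum; intros l.
  now apply Rmult_le_pos.
Qed.

Lemma catalan_term_S (y : R) (n : nat) :
  INR (catalan (S n)) * y ^ S n =
  y * sum_f_R0 (fun i => (INR (catalan i) * y ^ i) *
                         (INR (catalan (n - i)) * y ^ (n - i))) n.
Proof.
  rewrite INR_catalan_S, <- tech_pow_Rmult, Rmult_comm, Rmult_assoc.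
  f_equal. rewrite scal_sum.
  apply sum_eq; intros i Hi.
  replace (y ^ n) with (y ^ i * y ^ (n - i))
    by (rewrite <- pow_add; f_equal; lia).
  ring.
Qed.

Lemma catalan_quarter_nonneg (n : nat) : 0 <= INR (catalan n) * (/ 4) ^ n.
Proof. apply Rmult_le_pos; [apply pos_INR | apply pow_le; lra]. Qed.

Lemma catalan_partial_sum_le (N : nat) :
  sum_f_R0 (fun n => INR (catalan n) * (/ 4) ^ n) N <= 2.
Proof.
  induction N as [|N IH]; [simpl; lra|].
  set (a := fun n => INR (catalan n) * (/ 4) ^ n) in *.
  assert (H0 : 0 <= sum_f_R0 a N)
    by (apply cond_pos_sum; exact catalan_quarter_nonneg).
  assert (HC := cauchy_sum_le a N catalan_quarter_nonneg).
  rewrite decomp_sum by lia. simpl pred.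
  rewrite (sum_eq _ (fun k => sum_f_R0 (fun i => a i * a (k - i)%nat) k * / 4)).
  2: { intros k _. rewrite Rmult_comm. apply catalan_term_S. }
  rewrite <- scal_sum.
  replace (a 0%nat) with 1 by (unfold a; rewrite catalan_0; simpl; ring).
  (* The map s -> 1 + s^2 / 4 is increasing on s >= 0 and fixes 2, so it preserves the bound 2. *)
  nra.
Qed.

Lemma catalan_quarter_le (n : nat) : INR (catalan n) * (/ 4) ^ n <= 2.
Proof.
  assert (H := catalan_partial_sum_le n).
  destruct n as [|n]; [exact H|]. rewrite tech5 in H.
  assert (H0 := cond_pos_sum (fun n => INR (catalan n) * (/ 4) ^ n) n
                  catalan_quarter_nonneg).
  lra.
Qed.

Lemma catalan_PSeries_eq (y : R) :
  Rbar_lt (Rabs y) (CV_radius (fun n => INR (catalan n))) ->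
  PSeries (fun n => INR (catalan n)) y =
  1 + y * PSeries (fun n => INR (catalan n)) y ^ 2.
Proof.
  intros Hy. set (c := fun n => INR (catalan n)) in *.
  rewrite PSeries_decr_1 at 1 by now apply CV_radius_inside.
  (* By the recurrence, the shifted sequence is the Cauchy square of [c]. *)
  rewrite (PSeries_ext (PS_decr_1 c) (PS_mult c c)) by
    (intros n; apply INR_catalan_S).
  rewrite PSeries_mult by assumption.
  unfold c at 1. rewrite catalan_0. simpl. ring.
Qed.

Lemma catalan_bounded_le (t M : R) :
  (forall n, INR (catalan n) * t ^ n <= M) -> t <= / 4.
Proof.
  intros HM. apply Rnot_lt_le; intros Ht.
  (* Boundedness at [t] only gives that [t] is at most the radius; the midpoint [y] lies strictly
     inside and still exceeds 1/4. *)
  set (y := (/ 4 + t) / 2).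
  assert (Hr : Rbar_le t (CV_radius (fun n => INR (catalan n)))).
  { apply (proj1 (CV_radius_bounded _)). exists M; intros n.
    rewrite Rabs_pos_eq; [apply HM|].
    apply Rmult_le_pos; [apply pos_INR | apply pow_le; lra]. }
  assert (Hy : Rbar_lt (Rabs y) (CV_radius (fun n => INR (catalan n)))).
  { eapply Rbar_lt_le_trans; [|exact Hr].
    simpl. unfold y. rewrite Rabs_pos_eq; lra. }
  assert (E := catalan_PSeries_eq y Hy).
  assert (Hy4 : / 4 < y) by (unfold y; lra).
  revert E. generalize (PSeries (fun n => INR (catalan n)) y). intros x E.
  assert (Hsq : 0 <= (2 * y * x - 1) ^ 2) by apply pow2_ge_0.
  (* Completing the square in x = 1 + y x^2 exhibits the negative discriminant as a square. *)
  assert (E' : (2 * y * x - 1) ^ 2 = 1 - 4 * y) by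
    (replace ((2 * y * x - 1) ^ 2) with
       (1 - 4 * y + 4 * y * (1 + y * x ^ 2 - x)) by ring;
     rewrite <- E; ring).
  lra.
Qed.

(** Splitting off one factor A r leaves n-th powers only, so the odd terms are a constant multiple
    of the Catalan terms at y = |AB| r^2. *)
Lemma Rabs_u_coef_odd (A B r : R) (n : nat) :
  Rabs (u_coef A B (2 * n + 1) * r ^ (2 * n + 1)) =
  Rabs (A * r) * (INR (catalan n) * (Rabs (A * B) * r ^ 2) ^ n).
Proof.
  rewrite u_coef_odd, !pow_add, pow_mult.
  replace (INR (catalan n) * (A ^ n * A ^ 1) * B ^ n * ((r ^ 2) ^ n * r ^ 1))
    with ((A * r) * (INR (catalan n) * (A * B * r ^ 2) ^ n))
    by (rewrite !Rpow_mult_distr; ring).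
  rewrite !Rabs_mult, <- RPow_abs, !Rabs_mult.
  rewrite (Rabs_pos_eq (INR _)) by apply pos_INR.
  now rewrite (Rabs_pos_eq (r ^ 2)) by apply pow2_ge_0.
Qed.

Theorem lemma3p5 (A B : R) (hA : A <> 0) (hB : B <> 0) :
  CV_radius (u_coef A B) = Finite (1 / (2 * sqrt (Rabs (A * B)))).
Proof.
  assert (HP : 0 < Rabs (A * B))
    by (apply Rabs_pos_lt; now apply Rmult_integral_contrapositive).
  set (P := Rabs (A * B)) in *.
  assert (Hs : 0 < sqrt P) by now apply sqrt_lt_R0.
  assert (Hss : sqrt P * sqrt P = P) by (apply sqrt_sqrt; lra).
  set (rho := 1 / (2 * sqrt P)).
  assert (Hrho : 0 < rho) by (apply Rdiv_lt_0_compat; lra).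
  assert (Hq : P * rho ^ 2 = / 4)
    by (unfold rho; rewrite <- Hss at 1; field; lra).
  set (bounded := fun r => exists M, forall n, Rabs (u_coef A B n * r ^ n) <= M).
  (* The radius is the supremum of the r at which the terms stay bounded. *)
  enough (Hl : is_lub_Rbar bounded rho).
  { rewrite <- (is_lub_Rbar_unique _ _ Hl). symmetry.
    apply is_lub_Rbar_unique, CV_radius_bounded. }
  split.
  (* If r > [rho], then P r^2 > P rho^2 = 1/4, against the bound obtained after dividing by |A
     r|. *)
  - intros r [M HM]. simpl. apply Rnot_lt_le; intros Hr.
    assert (HAr : 0 < Rabs (A * r)).
    { apply Rabs_pos_lt, Rmult_integral_contrapositive; split; [assumption|lra]. }
    assert (Ht : P * r ^ 2 <= / 4).
    { apply catalan_bounded_le with (M / Rabs (A * r)); intros n.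
      apply (Rle_div_r _ _ _ HAr). rewrite Rmult_comm.
      unfold P. rewrite <- Rabs_u_coef_odd. apply HM. }
    assert (rho ^ 2 < r ^ 2) by nra.
    nra.
  (* The supremum is attained: at [rho] the Catalan argument is exactly 1/4, where the terms are at
     most 2. *)
  - intros b Hb. apply Hb. exists (Rabs (A * rho) * 2); intros n.
    destruct (Nat.Even_or_Odd n) as [[k ->]|[k ->]].
    + rewrite u_coef_even, Rmult_0_l, Rabs_R0.
      assert (0 <= Rabs (A * rho)) by apply Rabs_pos. lra.
    + rewrite Rabs_u_coef_odd. fold P. rewrite Hq.
      apply Rmult_le_compat_l; [apply Rabs_pos | apply catalan_quarter_le].
Qed.
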